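(* There exists a sequence $\{p_i\}_{i\ge 0}$ of numbers in $(0,1)$ with $\inf_{i\ge 0}p_i>0$, converging to a limit $p_\infty=\lim_{i\to\infty}p_i<1$, with the following property. Let $P$ be the $g$-function on $\{0,1\}^{\mathbb{Z}}$ defined by $$P(1\mid\underline{\omega})=p_{\ell(\underline{\omega})},\qquad P(0\mid\underline{\omega})=1-p_{\ell(\underline{\omega})},\qquad \underline{\omega}=(\omega_i)_{i\le -1}\in\{0,1\}^{(-\infty,-1]},$$ where $\ell(\underline{\omega})=\min\{j\ge 0:\omega_{-j-1}=1\}$, with $\ell(\underline{\omega})=\infty$ if $\omega_i=0$ for all $i\le -1$. Let $\mu$ be the (unique and non-null) $g$-measure on $\{0,1\}^{\mathbb{Z}}$ consistent with $P$, and let $X_0$ denote the coordinate at $0$. Then the two-sided conditional probability $$\mu\bigl(X_0=0\bigm|\cdot\,\bigr)$$ of $X_0=0$ given all the other coordinates $(X_i)_{i\ne 0}$ is essentially discontinuous at the all-zero configuration $0_{-\infty}^{+\infty}$.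
   Context: Let $E=\{0,1\}$ with the discrete $\sigma$-algebra, and let $\Omega=E^{\mathbb{Z}}$ with the product topology and the product $\sigma$-algebra $\mathcal{F}$. Let $(X_i)_{i\in\mathbb{Z}}$ be the coordinate process on $\Omega$. For $\Lambda\subset\mathbb{Z}$, let $\mathcal{F}_\Lambda$ be the sub-$\sigma$-algebra of $\mathcal{F}$ generated by $(X_i)_{i\in\Lambda}$. Regular $g$-function: a probability kernel $P(\omega_0\mid\omega_{-\infty}^{-1})$ from $E^{(-\infty,-1]}$ to $E$ such that, for each $\omega_0\in E$, the function $P(\omega_0\mid\cdot)$ is continuous in the product discrete topology of $E^{(-\infty,-1]}$ and strongly non-null, meaning bounded below by a constant $c>0$. Consistency ($g$-measure): a shift-invariant probability measure $\mu$ on $(\Omega,\mathcal{F})$ is a $g$-measure consistent (compatible) with $P$ if $$\mu\bigl(X_0=\omega_0\mid X_{-\infty}^{-1}=\omega_{-\infty}^{-1}\bigr)=P\bigl(\omega_0\mid\omega_{-\infty}^{-1}\bigr)$$ for all $\omega_0\in E$ and $\mu$-a.e. $\omega_{-\infty}^{-1}$. Non-null measure: $\mu$ is non-null if it gives nonzero measure to every cylinder, i.e. every event fixing the values of finitely many coordinates. Known fact: for every sequence $\{p_i\}$ in $(0,1)$ with $\inf_i p_i>0$ and $\lim_i p_i=p_\infty<1$, the kernel $P$ of the claim is a regular $g$-function, and there is exactly one shift-invariant probability measure $\mu$ consistent with it. This $\mu$ is non-null. Essential discontinuity: $\mu(X_0=0\mid\cdot)$ is essentially discontinuous at $\omega\in\Omega$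 if it has a discontinuity at $\omega$ that cannot be removed by redefinition on a set of $\mu$-measure zero. That is, no version of the conditional probability $\mu(X_0=0\mid\mathcal{F}_{\mathbb{Z}\setminus\{0\}})$, viewed as a function on $E^{\mathbb{Z}\setminus\{0\}}$ with the product topology, is continuous at the restriction $\omega_{\mathbb{Z}\setminus\{0\}}$. *)

(* Defs.v *)
From HB Require Import structures.
From mathcomp Require Import all_boot all_order all_algebra.
From mathcomp Require Import all_classical all_reals all_analysis.

Set Implicit Arguments.
Unset Strict Implicit.
Unset Printing Implicit Defensive.

Import Order.TTheory GRing.Theory Num.Theory.
Import numFieldNormedType.Exports.

Local Open Scope classical_set_scope.
Local Open Scope ring_scope.

(* [config I] is E^I with E = {0,1} = bool (0 is [false], 1 is [true]), with
   the product of the discrete topologies and the product sigma-algebra. *)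
Definition config (I : Type) : Type := I -> bool.

HB.instance Definition _ (I : Type) := Pointed.on (config I).
HB.instance Definition _ (I : Type) :=
  Topological.copy (config I) {ptws I -> bool}.

Definition coord_events (I : Type) (L : set I) : set (set (config I)) :=
  \bigcup_(i in L)
    preimage_set_system setT (fun w : config I => w i) measurable.

(* Sub-sigma-algebra of E^I generated by the coordinates in L. *)
Definition sigma_coord (I : Type) (L : set I) : set (set (config I)) :=
  <<s coord_events L >>.

HB.instance Definition _ (I : Type) :=
  Measurable.copy (config I) (g_sigma_algebraType (@coord_events I setT)).

Definition restr (L : set int) (w : config int) : config L :=
  fun i => w (val i).
Arguments restr L w : clear implicits.

Definition shift (w : config int) : config int := fun i => w (i + 1).

Definition past : set int := [set i | i <= -1].

Lemma past_subproof (j : nat) : - j%:Z - 1 \in past.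
Proof. by rewrite inE /past/= gerDr oppr_le0. Qed.

(* The coordinate -j-1 of the past. *)
Definition past_coord (j : nat) : past := SigSub (past_subproof j).

(* min {j >= 0 | w_(-j-1) = 1}, with [None] standing for infinity. *)
Definition ell (w : config past) : option nat :=
  if pselect (exists j, w (past_coord j)) is left ex then Some (ex_minn ex)
  else None.

Section GMeasures.
Context {R : realType}.
Implicit Types (P : bool -> config past -> R) (p : nat -> R).
Implicit Types (mu : probability (config int) R).

(* [P a w] is P(a | w). *)
Definition renewal_g p (pinf : R) (a : bool) (w : config past) : R :=
  let pl := if ell w is Some j then p j else pinf in
  if a then pl else 1 - pl.

Definition prob_kernel P : Prop :=
  [/\ forall a, measurable_fun setT (P a),
      forall a w, 0 <= P a w
    & forall w, P false w + P true w = 1].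

Definition regular_g_function P : Prop :=
  [/\ prob_kernel P,
      forall a, continuous (P a)
    & exists2 c : R, 0 < c & forall a w, c <= P a w].

(* [f] is a version of the conditional probability mu(B | F), for [F] a
   sub-sigma-algebra of the product sigma-algebra. *)
Definition cond_prob_version mu (F : set (set (config int)))
    (B : set (config int)) (f : config int -> R) : Prop :=
  [/\ forall Y : set R, measurable Y -> F (f @^-1` Y),
      mu.-integrable setT (EFin \o f)
    & forall A, F A -> (\int[mu]_(w in A) (f w)%:E = mu (B `&` A))%E].

Definition X0_eq (a : bool) : set (config int) := [set w | w 0 = a].

Definition shift_invariant mu : Prop :=
  forall A, measurable A -> mu (shift @^-1` A) = mu A.

Definition g_measure P mu : Prop :=
  shift_invariant mu /\
  forall a, exists2 f : config int -> R,
    cond_prob_version mu (sigma_coord past) (X0_eq a) f &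
    {ae mu, forall w, f w = P a (restr past w)}.

Definition non_null mu : Prop :=
  forall (J : seq int) (v : config int),
    mu [set w | forall i, i \in J -> w i = v i] != 0%E.

Definition off0 : set int := ~` [set 0].

(* An F_(Z \ {0})-measurable function on E^Z is a function on E^(Z \ {0})
   composed with [restr off0], hence the quantification over [g]. *)
Definition ess_discontinuous mu (w : config int) : Prop :=
  ~ exists g : config off0 -> R,
      cond_prob_version mu (sigma_coord off0) (X0_eq false)
        (g \o restr off0) /\
      {for restr off0 w, continuous g}.

End GMeasures.

(* Main.v *)
From HB Require Import structures.
Require Import Defs.
From mathcomp Require Import all_boot all_order all_algebra.
From mathcomp Require Import all_classical all_reals all_analysis.
From mathcomp Require Import measurable_realfun ring lra zify.

(** A renewal measure is described by T n, the probability of the word 0^n.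
    Its first and second decrements D n = T n - T n.+1 and E n = D n - D n.+1
    are the probabilities of 1 0^n and of 1 0^n 1, and p n = E n / D n is the
    probability that a run of n zeros after a one is ended by a one.
    Conversely, a sequence T with T 0 = 1, strictly convex and tending to 0,
    yields the g-function of the statement ([hazard T]) together with the
    probability [mass T] of every finite word under its g-measure, without
    any normalizing series.

    Given that the last one before 0 is at -(a+1) and the first one after 0
    is at b+1, the odds of X_0 = 0 against X_0 = 1 are
      E (a+b+1) : E a * E b / D 0,
    because the words 1 0^(a+b+1) 1 and 1 0^a 1 0^b 1 have these weights.
    Suppose that E (n+1) / E n tends to r.  For fixed b and a tending to
    infinity, the odds tend to r^(b+1) : E b / D 0.  A version that is
    continuous at the zero configuration forces all these limits to be close
    to one another for large b, so E b / r^b, if bounded, would converge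
    ([mass_ess_discontinuous]).  It therefore suffices that E b / r^b
    oscillates, but so slowly that the ratio E (n+1) / E n still converges.
    This is achieved with T n = 8^-n (1 + osc n), where osc n is a triangle
    wave of period 2 in log_2 (n+1).  Then p n tends to 7/8.

    The g-measure is constructed by coding points of [0,1) by nested
    intervals whose lengths are the prescribed word probabilities
    ([nested_interval_extension], [stationary_extension]).  Measures are
    compared through the words in a window, which form a pi-system up to
    marginals ([sigma_coord_unique_word]).

    One principle ([word_vanish]) settles both the consistency of the measure
    and its uniqueness: an additive function of words, F u = F 0u + F 1u, which
    vanishes on words starting with a one and for which F (0^n u) tends to 0,
    is zero.  For a word 1u the g-function is constant on the cylinder, since
    the age of the last one can be read in u, so both questions reduce to a
    computation there; long runs of zeros have small probability. *)

Set Implicit Arguments.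
Unset Strict Implicit.
Unset Printing Implicit Defensive.

Import Order.TTheory GRing.Theory Num.Theory.
Import numFieldNormedType.Exports.

Local Open Scope classical_set_scope.
Local Open Scope ring_scope.

Definition decrement {R : realType} (T : nat -> R) (n : nat) : R := T n - T n.+1.

(** The discrete hazard rate of the gap between two ones, when [T n] is the
    probability of n consecutive zeros. *)
Definition hazard {R : realType} (T : nat -> R) (n : nat) : R :=
  decrement (decrement T) n / decrement T n.

Lemma cvgn_ext {R : realType} (u v : nat -> R) (l : R) : (forall n, u n = v n) ->
  u n @[n --> \oo] --> l -> v n @[n --> \oo] --> l.
Proof. by move=> /funext ->. Qed.

(** * Probabilities of words under the stationary renewal law *)

(** Since F vanishes on 1u, additivity gives F u = F (0u) = F (00u) = ... *)
Lemma word_vanish {R : realType} (F : seq bool -> R) :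
  (forall u, F u = F (false :: u) + F (true :: u)) ->
  (forall u, F (true :: u) = 0) ->
  (forall u, F (nseq n false ++ u) @[n --> \oo] --> 0) ->
  forall u, F u = 0.
Proof.
move=> Fsplit F1 F0 u; rewrite -(cvg_lim _ (F0 u))//.
have -> : (fun n => F (nseq n false ++ u)) = (fun=> F u).
  apply/funext; elim=> [//|n <-] /=.
  by rewrite [in RHS]Fsplit F1 addr0.
by rewrite lim_cst.
Qed.

Section Words.
Context {R : realType} (T : nat -> R).
Hypotheses (T0 : T 0 = 1) (Tcvg : T n @[n --> \oo] --> 0)
  (Tconvex : forall n, 0 < decrement (decrement T) n).

(** The number of zeros since the last one after reading [u], when it was [j]
    before. *)
Fixpoint age (j : nat) (u : seq bool) : nat :=
  if u is b :: u' then age (if b then 0 else j.+1) u' else j.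

Definition step_weight (p : nat -> R) (j : nat) (b : bool) : R :=
  if b then p j else 1 - p j.

(** The transition probability of the chain of ages along the word [u]. *)
Fixpoint weight (p : nat -> R) (j : nat) (u : seq bool) : R :=
  if u is b :: u' then step_weight p j b * weight p (if b then 0 else j.+1) u'
  else 1.

(** The probability of the word 0^a u.  The prefix is an argument because the
    first one of [u] renews the process: only the run of zeros before it
    feels the stationary law. *)
Fixpoint zmass (a : nat) (u : seq bool) : R :=
  if u is b :: u' then
    if b then decrement T a * weight (hazard T) 0 u' else zmass a.+1 u'
  else T a.

Definition mass := zmass 0.

Lemma weight_rcons p j u b :
  weight p j (rcons u b) = weight p j u * step_weight p (age j u) b.
Proof.
elim: u j => [|c u ih] j /=; first by rewrite mulrC.
by rewrite ih mulrA.
Qed.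

Lemma step_weight_sum p j : step_weight p j false + step_weight p j true = 1.
Proof. exact: subrK. Qed.

Lemma weight_itv p j u : (forall n, 0 < p n < 1) -> 0 < weight p j u <= 1.
Proof.
move=> p01; elim: u j => [|b u ih] j /=; first by rewrite ltr01 lexx.
have /andP[w0 w1] := ih (if b then 0 else j.+1).
have /andP[s0 s1] : 0 < step_weight p j b <= 1.
  by have /andP[? ?] := p01 j; case: b {w0 w1} => /=; apply/andP; split; lra.
by rewrite mulr_gt0//= mulr_ile1// ltW.
Qed.

(** A sequence that decreases strictly to 0 is positive; this is how the
    convexity of [T] gives the positivity of [T] and of its decrements. *)
Lemma strictly_decreasing_cvg0_gt0 (u : nat -> R) : (forall n, 0 < decrement u n) ->
  u n @[n --> \oo] --> 0 -> forall n, 0 < u n.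
Proof.
move=> ud u0 n.
have : 0 <= u n.+1.
  rewrite -(cvg_lim _ u0)//; apply: nonincreasing_cvgn_ge; last first.
    by apply/cvg_ex; exists 0.
  apply/nonincreasing_seqP => k.
  by have := ud k; rewrite /decrement; lra.
by have := ud n; rewrite /decrement; lra.
Qed.

Let decrement_cvg0 : decrement T n @[n --> \oo] --> 0.
Proof.
rewrite -[X in _ --> X](subrr 0); apply: cvgB => //.
by rewrite (@cvg_shiftS _ T).
Qed.

Lemma decrement_gt0 n : 0 < decrement T n.
Proof. exact: strictly_decreasing_cvg0_gt0. Qed.

Let T_gt0 n : 0 < T n.
Proof. by apply: strictly_decreasing_cvg0_gt0 => //; exact: decrement_gt0. Qed.

Lemma hazard01 n : 0 < hazard T n < 1.
Proof.
rewrite /hazard divr_gt0 ?decrement_gt0//= ltr_pdivrMr ?decrement_gt0// mul1r.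
by have := decrement_gt0 n.+1; rewrite [decrement (decrement T) n]/decrement; lra.
Qed.

Lemma decrement_hazard n : decrement T n * hazard T n = decrement (decrement T) n.
Proof. by rewrite mulrC divfK// gt_eqF// decrement_gt0. Qed.

Lemma decrement_hazardC n : decrement T n * (1 - hazard T n) = decrement T n.+1.
Proof. by rewrite mulrBr mulr1 decrement_hazard /decrement; ring. Qed.

(** The word 0^a u is preceded by a zero or by a one; the second term is the
    probability of 1 0^a u. *)
Lemma zmass_split a u :
  zmass a u = zmass a.+1 u + decrement T a * weight (hazard T) a u.
Proof.
elim: u a => [|[] u ih] a /=; first by rewrite mulr1 /decrement addrC subrK.
  by rewrite mulrA -mulrDl decrement_hazard /decrement; congr *%R; ring.
by rewrite ih mulrA decrement_hazardC.
Qed.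

Lemma mass_split u : mass u = mass (false :: u) + mass (true :: u).
Proof. by rewrite /mass zmass_split. Qed.

Lemma mass_rcons u : mass u = mass (rcons u false) + mass (rcons u true).
Proof.
rewrite /mass; elim: u 0%N => [|[] u ih] a /=; last exact: ih.
  by rewrite /decrement; ring.
by rewrite !weight_rcons -!mulrDr step_weight_sum mulr1.
Qed.

Lemma zmass_gt0 a u : 0 < zmass a u.
Proof.
elim: u a => [|[] u ih] a //=.
by rewrite mulr_gt0 ?decrement_gt0//; have /andP[] := weight_itv 0 u hazard01.
Qed.

Lemma mass_gt0 u : 0 < mass u. Proof. exact: zmass_gt0. Qed.

Lemma mass_nil : mass [::] = 1. Proof. by rewrite /mass /= T0. Qed.

Let zmass_le a u : zmass a u <= T a.
Proof.
elim: u a => [|[] u ih] a //=.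
  have /andP[_ w1] := weight_itv 0 u hazard01.
  apply: (@le_trans _ _ (decrement T a)); first by rewrite ler_piMr// ltW ?decrement_gt0.
  by rewrite /decrement lerBlDr lerDl ltW.
by apply: le_trans (ih a.+1) _; have := decrement_gt0 a; rewrite /decrement; lra.
Qed.

Lemma mass_zeros_cvg0 u : mass (nseq n false ++ u) @[n --> \oo] --> 0.
Proof.
apply: (@squeeze_cvgr _ _ _ _ (fun=> 0) T) => //; last exact: cvg_cst.
have E a n : zmass a (nseq n false ++ u) = zmass (a + n) u.
  by elim: n a => [|n ih] a /=; rewrite ?addn0// ih addnS.
by apply: nearW => n; rewrite ltW ?mass_gt0//= /mass E zmass_le.
Qed.

(** By proportionality: a constant multiple of [mass] agrees with [N] on the
    words starting with a one, hence everywhere by [word_vanish], and the empty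
    word shows that the constant is 1. *)
Lemma mass_unique (N : seq bool -> R) :
  N [::] = 1 ->
  (forall u, N u = N (false :: u) + N (true :: u)) ->
  (forall u, N (true :: u) = N [:: true] * weight (hazard T) 0 u) ->
  (forall u, N (nseq n false ++ u) @[n --> \oo] --> 0) ->
  forall u, N u = mass u.
Proof.
move=> N0 Nsplit N1 Nz.
(* The word 1 has mass D 0. *)
pose c := N [:: true] / decrement T 0.
have Nc u : N u = c * mass u.
  apply/eqP; rewrite -subr_eq0; apply/eqP; move: u.
  apply: (@word_vanish R (fun u => N u - c * mass u)) => [u|u|u].
  - by rewrite Nsplit mass_split; ring.
  - by rewrite N1 /mass /= /c mulrA divfK ?subrr// gt_eqF// decrement_gt0.
  - rewrite -[X in _ --> X](subrr 0) -[X in _ --> _ - X](mulr0 c).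
    apply: cvgB; first exact: Nz.
    by apply: cvgM; [exact: cvg_cst|exact: mass_zeros_cvg0].
have c1 : c = 1 by have := Nc [::]; rewrite mass_nil N0 mulr1.
by move=> u; rewrite Nc c1 mul1r.
Qed.

(** Along a run of zeros the factors 1 - p i telescope, because
    D i (1 - p i) = D (i+1). *)
Lemma mass_gap a u : mass (true :: nseq a false ++ true :: u)
  = decrement (decrement T) a * weight (hazard T) 0 u.
Proof.
have E j : decrement T j * weight (hazard T) j (nseq a false ++ true :: u)
    = decrement (decrement T) (j + a) * weight (hazard T) 0 u.
  elim: a j => [|a ih] j /=; first by rewrite addn0 mulrA decrement_hazard.
  by rewrite mulrA decrement_hazardC ih addnS.
by rewrite /mass /= E.
Qed.

Lemma mass_gap1 a : mass (true :: nseq a false ++ [:: true]) = decrement (decrement T) a.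
Proof. by rewrite mass_gap mulr1. Qed.

Lemma mass_gap2 a b :
  mass (true :: nseq a false ++ true :: nseq b false ++ [:: true])
  = decrement (decrement T) a * decrement (decrement T) b / decrement T 0.
Proof.
rewrite mass_gap -mulrA; congr *%R.
by rewrite -[in RHS]mass_gap1 /mass /= mulrC mulKf// gt_eqF// decrement_gt0.
Qed.

End Words.

(** * Cylinders: topology and sigma-algebras *)

Definition box {I : eqType} (J : seq I) (v : config I) : set (config I) :=
  [set w | forall i, i \in J -> w i = v i].

Section Boxes.
Context {I : choiceType}.

Lemma boxS (J K : seq I) v : {subset J <= K} -> box K v `<=` box J v.
Proof. by move=> JK w wK i /JK; exact: wK. Qed.

Lemma box_cons i (J : seq I) v : box (i :: J) v = [set w | w i = v i] `&` box J v.
Proof.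
apply/seteqP; split=> [w wv|w [wi wJ] k].
  by split; [apply: wv; rewrite mem_head|move=> k kJ; apply: wv; rewrite inE kJ orbT].
by rewrite inE => /predU1P[->//|]; exact: wJ.
Qed.

Lemma box_nbhs (J : seq I) (w : config I) : nbhs w (box J w).
Proof.
elim: J => [|i J ih]; first by apply: filterS filterT => ? _ i.
rewrite box_cons; apply: filterI => //.
have : {for w, continuous (fun v : config I => v i)}.
  exact: (@proj_continuous I (fun=> bool) i).
move=> /(_ [set b | b = w i]); apply.
apply: open_nbhs_nbhs; split; last by [].
exact: discrete_open.
Qed.

(** The supersets of finite cylinders around [w] form a filter which converges
    to [w] coordinatewise, hence in the product topology. *)
Lemma nbhs_box (w : config I) (U : set (config I)) : nbhs w U ->
  exists J : seq I, box J w `<=` U.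
Proof.
pose F : set_system (config I) := [set U | exists J : seq I, box J w `<=` U].
have FF : Filter F.
  split.
  - by exists [::].
  - move=> A B [J JA] [K KB]; exists (J ++ K) => v vJK; split.
      by apply: JA => i iJ; apply: vJK; rewrite mem_cat iJ.
    by apply: KB => i iJ; apply: vJK; rewrite mem_cat iJ orbT.
  - by move=> A B AB [J JA]; exists J; exact: subset_trans AB.
suff : F --> w by apply.
apply/cvg_sup => i; rewrite cvg_image; last first.
  by rewrite eqEsubset; split=> b // _; exists (fun=> b).
move=> A /= /nbhs_singleton Awi; exists ((fun v : config I => v i) @^-1` A).
  by exists [:: i] => v /(_ i (mem_head _ _)) vi; rewrite /= vi.
by rewrite eqEsubset; split => [_ [v ? <-//]|b Ab]; exists (fun=> b).
Qed.

Lemma sigma_coord_coord (L : set I) i b : L i ->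
  sigma_coord L [set w : config I | w i = b].
Proof.
move=> Li; apply: sub_sigma_algebra; exists i => //=; exists [set b] => //.
by rewrite setTI.
Qed.

Lemma sigma_coord_box (L : set I) (J : seq I) v :
  (forall i, i \in J -> L i) -> sigma_coord L (box J v).
Proof.
elim: J => [_|i J ih JL].
  have -> : box [::] v = setT by apply/seteqP; split.
  exact: (@measurableT _ (g_sigma_algebraType (coord_events L))).
rewrite box_cons; apply: (@measurableI _ (g_sigma_algebraType (coord_events L))).
  by apply: sigma_coord_coord; apply: JL; rewrite mem_head.
by apply: ih => j jJ; apply: JL; rewrite inE jJ orbT.
Qed.

Lemma sigma_coord_measurable (L : set I) A :
  sigma_coord L A -> measurable (A : set (config I)).
Proof.
apply: sub_sigma_algebra2 => _ [i Li [Y mY <-]]; exists i => //.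
by exists Y.
Qed.

Lemma measurable_box (J : seq I) v : measurable (box J v).
Proof. exact: (@sigma_coord_box setT). Qed.

End Boxes.

(** * Comparing measures through words *)

Section Unique.
Context {R : realType} {I : choiceType}.
Implicit Types (m : {measure set (config I) -> \bar R}).

(** Cylinders over finite subsets of [L], together with the empty set, form a
    pi-system that generates the sigma-algebra. *)
Lemma sigma_coord_unique (L : set I) m1 m2 :
  (m1 setT < +oo)%E ->
  (forall J v, (forall i, i \in J -> L i) -> m1 (box J v) = m2 (box J v)) ->
  forall A, sigma_coord L A -> m1 A = m2 A.
Proof.
move=> m1oo m12.
pose G : set (set (config I)) := [set A | A = set0 \/
  exists J v, (forall i, i \in J -> L i) /\ A = box J v].
have GT : G setT.
  by right; exists [::], (fun=> false); split=> //; apply/seteqP; split.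
have LG : sigma_coord L `<=` <<s G >>.
  apply: smallest_sub; first exact: smallest_sigma_algebra.
  move=> _ [i Li [Y mY <-]]; rewrite setTI.
  have -> : (fun w : config I => w i) @^-1` Y =
      \bigcup_(b in Y) [set w : config I | w i = b].
    apply/seteqP; split=> [w Ywi|w [b Yb] /= ->//].
    by exists (w i).
  apply: (@fin_bigcup_measurable _ (g_sigma_algebraType G)) => // b Yb.
  apply: sub_sigma_algebra; right; exists [:: i], (fun=> b); split.
    by move=> j; rewrite inE => /eqP ->.
  by apply/seteqP; split=> [w wi j|w]; [rewrite inE => /eqP ->|apply; rewrite mem_head].
move=> A /LG; apply: (@g_sigma_algebra_measure_unique _ _ _ G _ (fun=> setT)) => //.
- move=> B [->//|[J [v [_ ->]]]]; exact: measurable_box.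
- by rewrite bigcup_const.
- move=> A1 A2 [->|[J [v [JL ->]]]]; first by left; rewrite set0I.
  move=> [->|[K [v' [KL ->]]]]; first by left; rewrite setI0.
  have [AB|/set0P[w [wJ wK]]] := eqVneq (box J v `&` box K v') set0.
    by left.
  right; exists (J ++ K), w; split.
    by move=> i; rewrite mem_cat => /orP[/JL|/KL].
  apply/seteqP; split=> w' => [[w'J w'K] i|w'JK].
    by rewrite mem_cat => /orP[iJ|iK]; [rewrite w'J ?wJ|rewrite w'K ?wK].
  by split=> i iJ; rewrite w'JK ?mem_cat ?iJ ?orbT//; [exact: wJ|exact: wK].
- by move=> B [->|[J [v [JL ->]]]]; [rewrite !measure0|exact: m12].
Qed.

(** A coordinate can be forgotten by summing over its two values. *)
Lemma box_coarsen m1 m2 (J K : seq I) : {subset J <= K} ->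
  (forall v, m1 (box K v) = m2 (box K v)) ->
  forall v, m1 (box J v) = m2 (box J v).
Proof.
move=> JK mK.
have {JK mK} : forall v, m1 (box (K ++ J) v) = m2 (box (K ++ J) v).
  move=> v; have -> : box (K ++ J) v = box K v; last exact: mK.
  apply/seteqP; split; apply: boxS => i; rewrite mem_cat; first by move=> ->.
  by move=> /orP[//|/JK].
elim: K => [//|i K ih] mK; apply: ih => v.
move: mK; rewrite cat_cons; move: (K ++ J) => {}J mJ.
have [iJ|iJ] := boolP (i \in J).
  have -> : box J v = box (i :: J) v; last exact: mJ.
  apply/seteqP; split; apply: boxS => j; last by rewrite inE => ->; rewrite orbT.
  by rewrite inE => /predU1P[->|].
pose u b : config I := fun j => if j == i then b else v j.
have E : box J v = box (i :: J) (u false) `|` box (i :: J) (u true).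
  have ub b : box (i :: J) (u b) = [set w | w i = b] `&` box J v.
    rewrite box_cons {1}/u eqxx; congr (_ `&` _).
    apply/seteqP; split=> w wJ j jJ; rewrite wJ// /u; case: eqP jJ => // ->;
      by rewrite (negPf iJ).
  rewrite !ub -setIUl; apply/seteqP; split=> w; last by case.
  by move=> wJ; split=> //=; case: (w i); [right|left].
have dis : box (i :: J) (u false) `&` box (i :: J) (u true) = set0.
  apply/seteqP; split=> // w.
  move=> [/(_ i (mem_head _ _)) + /(_ i (mem_head _ _))].
  by rewrite /u eqxx => ->.
rewrite E !measureU //; try exact: measurable_box.
by congr (_ + _)%E; exact: mJ.
Qed.

End Unique.

(** Cylinders over intervals, indexed by words so that letters can be added and
    deleted at both ends. *)
Fixpoint word_at (s : int) (u : seq bool) : set (config int) :=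
  if u is b :: u' then [set w | w s = b] `&` word_at (s + 1) u' else setT.

Lemma word_at_cons s b u :
  word_at s (b :: u) = [set w | w s = b] `&` word_at (s + 1) u.
Proof. by []. Qed.

Definition window (s : int) (n : nat) : seq int := [seq s + i%:Z | i <- iota 0 n].

Lemma mem_window s n i : (i \in window s n) = (s <= i < s + n%:Z).
Proof.
apply/mapP/idP => [[k]|/andP[si isn]].
  by rewrite mem_iota add0n => /= kn ->; rewrite lerDl ltrD2l ltz_nat kn.
exists `|i - s|%N; last lia.
by rewrite mem_iota; lia.
Qed.

Lemma window_cons s n : window s n.+1 = s :: window (s + 1) n.
Proof.
rewrite /window /= addr0; congr (_ :: _); rewrite (iotaDl 1 0) -map_comp.
by apply: eq_map => i /=; rewrite PoszD addrA.
Qed.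

Lemma word_at_box s (v : config int) n :
  word_at s [seq v i | i <- window s n] = box (window s n) v.
Proof.
elim: n s => [|n ih] s; first by apply/seteqP; split.
by rewrite window_cons/= ih box_cons.
Qed.

Lemma measurable_word_at s u : measurable (word_at s u).
Proof.
elim: u s => [|b u ih] s /=; first exact: measurableT.
apply: measurableI => //; apply: (@sigma_coord_measurable _ setT).
exact: sigma_coord_coord.
Qed.

Lemma word_at_rcons s u b :
  word_at s (rcons u b) = word_at s u `&` [set w | w (s + (size u)%:Z) = b].
Proof.
elim: u s => [|c u ih] s /=; first by rewrite addr0 setTI setIT.
by rewrite ih setIA -[in RHS](add1n (size u)) PoszD addrA.
Qed.

Lemma word_at_cat s u v :
  word_at s (u ++ v) = word_at s u `&` word_at (s + (size u)%:Z) v.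
Proof.
elim: u s => [|b u ih] s /=; first by rewrite addr0 setTI.
by rewrite ih setIA -[in RHS](add1n (size u)) PoszD addrA.
Qed.

Lemma sigma_coord_word_at (L : set int) s u :
  (forall i, s <= i < s + (size u)%:Z -> L i) -> sigma_coord L (word_at s u).
Proof.
elim: u s => [|b u ih] s sL.
  exact: (@measurableT _ (g_sigma_algebraType (coord_events L))).
apply: (@measurableI _ (g_sigma_algebraType (coord_events L))).
  by apply: sigma_coord_coord; apply: sL => /=; lia.
by apply: ih => i /= h; apply: sL => /=; lia.
Qed.

Lemma word_at_zeros s n w :
  word_at s (nseq n false) w <-> forall i, s <= i < s + n%:Z -> w i = false.
Proof.
elim: n s => [|n ih] s /=; first by split=> // _ i; lia.
rewrite ih; split=> [[ws wn] i si|wn].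
  by have [->//|si'] := eqVneq i s; apply: wn; lia.
by split=> [|i si]; apply: wn; lia.
Qed.

Lemma word_at_splitl s u :
  word_at s u = word_at (s - 1) (false :: u) `|` word_at (s - 1) (true :: u).
Proof.
rewrite !word_at_cons subrK -setIUl; apply/seteqP; split=> w; last by case.
by move=> wu; split=> //=; case: (w _); [right|left].
Qed.

Lemma word_at_splitr s u :
  word_at s u = word_at s (rcons u false) `|` word_at s (rcons u true).
Proof.
rewrite !word_at_rcons -setIUr; apply/seteqP; split=> w; last by case.
by move=> wu; split=> //=; case: (w _); [right|left].
Qed.

Lemma shift_word_at s u : Defs.shift @^-1` word_at s u = word_at (s + 1) u.
Proof. by elim: u s => // b u ih s /=; rewrite preimage_setI ih. Qed.

Section WordMeasure.
Context {R : realType}.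
Implicit Types m : {measure set (config int) -> \bar R}.

Lemma word_at_measurel m s u : m (word_at s u) =
  (m (word_at (s - 1) (false :: u)) + m (word_at (s - 1) (true :: u)))%E.
Proof.
rewrite {1}word_at_splitl measureU//; try exact: measurable_word_at.
by apply/seteqP; split=> // w [[/= ->]] _ [].
Qed.

Lemma word_at_measurer m s u : m (word_at s u) =
  (m (word_at s (rcons u false)) + m (word_at s (rcons u true)))%E.
Proof.
rewrite {1}word_at_splitr measureU//; try exact: measurable_word_at.
by rewrite !word_at_rcons; apply/seteqP; split=> // w [[_ /= ->]] [_].
Qed.

(** It is enough to compare words of full length in windows that exhaust [L],
    since smaller cylinders are marginals of these. *)
Lemma sigma_coord_unique_word (L : set int) m1 m2 :
  (m1 setT < +oo)%E ->
  (forall J : seq int, (forall i, i \in J -> L i) -> exists s n,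
    [/\ {subset J <= window s n} &
        forall u, size u = n -> m1 (word_at s u) = m2 (word_at s u)]) ->
  forall A, sigma_coord L A -> m1 A = m2 A.
Proof.
move=> m1oo m12; apply: sigma_coord_unique => // J v JL.
have [s [n [Js sn]]] := m12 J JL.
apply: (box_coarsen Js) => {}v; rewrite -word_at_box; apply: sn.
by rewrite !size_map size_iota.
Qed.

Lemma subset_window (J : seq int) : exists k : nat,
  {subset J <= window (- k%:Z) k.*2.+1}.
Proof.
elim: J => [|i J [k ih]]; first by exists 0%N.
(* Enlarging by the absolute value of i keeps the window symmetric. *)
exists (k + `|i|)%N => j; rewrite inE mem_window => /predU1P[->|/ih].
  by lia.
by rewrite mem_window; lia.
Qed.

Lemma measure_unique_word m1 m2 :
  (m1 setT < +oo)%E ->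
  (forall s u, m1 (word_at s u) = m2 (word_at s u)) ->
  forall A, measurable A -> m1 A = m2 A.
Proof.
move=> m1oo m12; apply: (@sigma_coord_unique_word setT) => // J _.
by have [k Jk] := subset_window J; exists (- k%:Z), k.*2.+1; split.
Qed.

End WordMeasure.

(** * Construction of measures on binary sequences *)

(** The word lists the coordinates from the most recently sampled one, so that
    sampling one more coordinate is a [cons]. *)
Fixpoint history {I : Type} (pos : nat -> I) (t : seq bool) : set (config I) :=
  if t is b :: t' then [set w | w (pos (size t')) = b] `&` history pos t' else setT.

Section Coding.
Context {R : realType} {I : choiceType}.
Variables (pos : nat -> I) (rank : I -> nat) (M : seq bool -> R).
Hypotheses (posK : cancel pos rank) (M0 : M [::] = 1) (M_ge0 : forall t, 0 <= M t)
  (Msplit : forall t, M t = M (false :: t) + M (true :: t)).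

(** The interval of the word [t] starts at [left_end t] and has length [M t];
    the intervals of 0t and 1t divide it, in this order, at [cut t]. *)
Fixpoint left_end (t : seq bool) : R :=
  if t is b :: t' then left_end t' + (if b then M (false :: t') else 0) else 0.

Definition cut (t : seq bool) : R := left_end t + M (false :: t).

Fixpoint code (x : R) (n : nat) : seq bool :=
  if n is n'.+1 then (cut (code x n') <= x) :: code x n' else [::].

Definition decode (x : R) : config I := fun i => cut (code x (rank i)) <= x.

(** The words of length n label a partition of [0,1) into intervals, and
    [code x n] is the label of the interval of [x]. *)
Lemma code_itv x t : 0 <= x < 1 ->
  code x (size t) = t <-> left_end t <= x < left_end t + M t.
Proof.
move=> x01; elim: t => [|b t ih] /=; first by rewrite M0 add0r x01.
have Mt := Msplit t; have Mf := M_ge0 (false :: t); have Mt' := M_ge0 (true :: t).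
split=> [[<- e]|].
  have /ih/andP[x1 x2] := e; rewrite e.
  by case: (lerP (cut t) x); rewrite /cut => ?; apply/andP; split; lra.
case: b => /andP[x1 x2].
  have e : code x (size t) = t by apply/ih; apply/andP; split; lra.
  by rewrite e /cut x1.
have e : code x (size t) = t by apply/ih; apply/andP; split; lra.
by rewrite e /cut; congr (_ :: _); apply/negbTE; rewrite -ltNge; lra.
Qed.

Lemma decode_history x t : history pos t (decode x) <-> code x (size t) = t.
Proof.
elim: t => [//|b t ih] /=; rewrite /decode posK; split.
  by move=> [<- /ih ->].
by move=> [<- e]; split; [rewrite e|apply/ih].
Qed.

Lemma measurable_code n t : measurable [set x | code x n = t].
Proof.
elim: n t => [|n ih] [|b t].
- by rewrite (_ : [set _ | _] = setT)//; apply/seteqP; split.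
- by rewrite (_ : [set _ | _] = set0)//; apply/seteqP; split.
- by rewrite (_ : [set _ | _] = set0)//; apply/seteqP; split.
have -> : [set x | code x n.+1 = b :: t] = [set x | code x n = t] `&`
    (if b then `[cut t, +oo[%classic else `]-oo, cut t[%classic).
  apply/seteqP; split=> x /=; case: b => /=; rewrite in_itv/= ?andbT.
  + by move=> [h e]; split=> //; rewrite -e h.
  + by move=> [h e]; split=> //; rewrite ltNge -e h.
  + by move=> [-> ->].
  + by move=> [->]; rewrite ltNge => /negbTE ->.
by apply: measurableI => //; case: b; exact: measurable_itv.
Qed.

Lemma measurable_decode : measurable_fun setT decode.
Proof.
apply: (@measurability _ _ _ _ _ _ (coord_events setT)) => //.
move=> _ [_ [i _ [Y _ <-]] <-]; rewrite !setTI.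
have -> : decode @^-1` ((fun w : config I => w i) @^-1` Y) =
    \bigcup_t ([set x | code x (rank i).+1 = t] `&`
       [set _ | Y (head false t)]).
  apply/seteqP; split=> [x Yx|x [t _ [/= <-]] //].
  by exists (code x (rank i).+1).
apply: countable_bigcupT_measurable => // t.
apply: measurableI; first exact: measurable_code.
have [Yt|nYt] := pselect (Y (head false t)).
  by rewrite (_ : [set _ | _] = setT)//; apply/seteqP; split.
by rewrite (_ : [set _ | _] = set0)//; apply/seteqP; split.
Qed.

(** The image of the uniform law on [0,1) under [decode]. *)
Definition coding_prob : set (config I) -> \bar R := fun A =>
  lebesgue_measure (decode @^-1` A `&` `[0, 1[%classic).

Let coding0 : coding_prob set0 = 0%E.
Proof. by rewrite /coding_prob preimage_set0 set0I measure0. Qed.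

Let coding_ge0 A : (0 <= coding_prob A)%E.
Proof. exact: measure_ge0. Qed.

Let coding_sigma_additive : semi_sigma_additive coding_prob.
Proof.
move=> F mF tF mUF; rewrite /coding_prob preimage_bigcup setI_bigcupl.
have mG n : measurable (decode @^-1` F n `&` `[0, 1[%classic : set R).
  apply: measurableI; last exact: measurable_itv.
  by rewrite -[X in measurable X]setTI; exact: measurable_decode.
apply: measure_semi_sigma_additive => //.
  apply/trivIsetP => i j _ _ ij; rewrite setIACA -preimage_setI.
  by move/trivIsetP : tF => -> //; rewrite preimage_set0 set0I.
exact: bigcupT_measurable.
Qed.

HB.instance Definition _ := isMeasure.Build _ _ _ coding_prob
  coding0 coding_ge0 coding_sigma_additive.

Let coding_setT : coding_prob setT = 1%E.
Proof.
by rewrite /coding_prob preimage_setT setTI lebesgue_measure_itv/= lte_fin ltr01 oppr0 adde0.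
Qed.

HB.instance Definition _ :=
  Measure_isProbability.Build _ _ _ coding_prob coding_setT.

Lemma coding_prob_history t : coding_prob (history pos t) = (M t)%:E.
Proof.
have bnds u : 0 <= left_end u /\ left_end u + M u <= 1.
  elim: u => [|b u [ih1 ih2]] /=; first by rewrite M0 add0r.
  have Mt := Msplit u; have Mf := M_ge0 (false :: u); have Mt' := M_ge0 (true :: u).
  by case: b; split; lra.
have [l0 u1] := bnds t.
have -> : coding_prob (history pos t) =
    lebesgue_measure (`[left_end t, left_end t + M t[%classic : set R).
  congr lebesgue_measure; apply/seteqP; split=> x /=; rewrite !in_itv/=.
    by move=> [/decode_history h x01]; apply/code_itv.
  move=> /andP[x1 x2].
  have x01 : 0 <= x < 1 by apply/andP; split; lra.
  by split=> //; apply/decode_history/code_itv => //; rewrite x1.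
rewrite lebesgue_measure_itv/= lte_fin ltrDl.
case: ifPn => [_|]; first by rewrite -EFinD; congr EFin; ring.
by rewrite -leNgt => M0'; congr EFin; apply/eqP; rewrite eq_le M_ge0 M0'.
Qed.

End Coding.

(** A Kolmogorov extension theorem without a compactness argument: countable
    additivity is inherited from the Lebesgue measure. *)
Lemma nested_interval_extension {R : realType} {I : choiceType} (pos : nat -> I)
    (rank : I -> nat) (M : seq bool -> R) :
  cancel pos rank -> M [::] = 1 -> (forall t, 0 <= M t) ->
  (forall t, M t = M (false :: t) + M (true :: t)) ->
  exists mu : probability (config I) R, forall t, mu (history pos t) = (M t)%:E.
Proof.
move=> posK M0 M_ge0 Msplit; exists (coding_prob rank M) => t.
exact: coding_prob_history.
Qed.

(** * Two-sided stationary laws *)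

(** The integers in the order 0, -1, 1, -2, 2, ..., so that the first n
    positions always form a window of Z, which grows at its two ends in turn. *)
Definition alternating_pos (n : nat) : int :=
  if odd n then Negz n./2 else Posz n./2.

Definition alternating_rank (i : int) : nat :=
  match i with Posz k => k.*2 | Negz k => k.*2.+1 end.

Lemma alternating_posK : cancel alternating_pos alternating_rank.
Proof.
move=> n; rewrite /alternating_pos; case: ifP => /= on; rewrite -[RHS]odd_double_half on //.
Qed.

(** Rearranges a word listed in sampling order into its order on the line. *)
Fixpoint spatial (t : seq bool) : seq bool :=
  if t is b :: t' then
    if odd (size t') then b :: spatial t' else rcons (spatial t') b
  else [::].

Lemma size_spatial t : size (spatial t) = size t.
Proof. by elim: t => //= b t; case: odd => /=; rewrite ?size_rcons => ->. Qed.

Lemma spatial_surj n u : size u = n -> exists2 t, size t = n & spatial t = u.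
Proof.
elim: n u => [|n ih] u su.
  by exists [::] => //; apply/esym/size0nil.
have [on|en] := boolP (odd n).
  case: u su => [//|b u [/ih[t st tu]]].
  by exists (b :: t); rewrite /= st ?on ?tu.
case/lastP: u su => [//|u b]; rewrite size_rcons => -[/ih[t st tu]].
by exists (b :: t); rewrite /= st ?(negPf en) ?tu.
Qed.

Lemma history_word_at t :
  history alternating_pos t = word_at (- ((size t)./2)%:Z) (spatial t).
Proof.
elim: t => [//|b t ih]; rewrite [history _ _]/= ih /=.
rewrite /alternating_pos uphalf_half; case: ifP => on /=.
  rewrite NegzE add1n; congr (_ `&` _); congr word_at; lia.
rewrite add0n setIC word_at_rcons size_spatial; congr (_ `&` _).
apply/seteqP; split => w /= <-; congr w;
 rewrite -[in LHS](odd_double_half (size t)) on; lia.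
Qed.

(** Word probabilities that are consistent under deleting either end letter
    define a law on two-sided sequences.  The extension fixes the words in the
    centered windows; any other window is cut out of a large centered one by
    deleting letters on the left and on the right. *)
Lemma stationary_extension {R : realType} (m : seq bool -> R) :
  m [::] = 1 -> (forall u, 0 <= m u) ->
  (forall u, m u = m (false :: u) + m (true :: u)) ->
  (forall u, m u = m (rcons u false) + m (rcons u true)) ->
  exists mu : probability (config int) R,
    forall s u, mu (word_at s u) = (m u)%:E.
Proof.
move=> m0 m_ge0 ml mr.
have [mu muE] : exists mu : probability (config int) R,
    forall t, mu (history alternating_pos t) = (m (spatial t))%:E.
  apply: (nested_interval_extension alternating_posK) => //= t.
  by case: odd; [exact: ml|exact: mr].
exists mu.
have left s n : (forall u, size u = n.+1 -> mu (word_at s u) = (m u)%:E) ->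
    forall u, size u = n -> mu (word_at (s + 1) u) = (m u)%:E.
  move=> h u su; rewrite word_at_measurel addrK ml EFinD.
  by congr (_ + _)%E; apply: h; rewrite /= su.
have right s n : (forall u, size u = n.+1 -> mu (word_at s u) = (m u)%:E) ->
    forall u, size u = n -> mu (word_at s u) = (m u)%:E.
  move=> h u su; rewrite word_at_measurer mr EFinD.
  by congr (_ + _)%E; apply: h; rewrite size_rcons su.
have centered n u : size u = n -> mu (word_at (- (n./2)%:Z) u) = (m u)%:E.
  move=> /spatial_surj[t st <-]; rewrite -{1}st -history_word_at.
  exact: muE.
have shrink s n k l : (forall u, size u = (n + k + l)%N -> mu (word_at s u) = (m u)%:E) ->
    forall u, size u = n -> mu (word_at (s + k%:Z) u) = (m u)%:E.
  elim: k s => [|k ih] s h; last first.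
    rewrite -add1n PoszD addrA; apply: ih; apply: left => u.
    by rewrite -addSn -addnS; exact: h.
  rewrite addr0; move: h; rewrite addn0; elim: l => [|l ih] h.
    by rewrite addn0 in h.
  by apply: ih; apply: right => u; rewrite -addnS; exact: h.
move=> s u; pose k := (`|s| + size u)%N.
(* The number of letters deleted on the left: s + k is nonnegative. *)
pose j := absz (s + k%:Z).
have -> : s = - (k.*2./2)%:Z + j%:Z by rewrite doubleK; lia.
apply: (@shrink _ (size u) _ (k.*2 - size u - j)%N) => // v sv.
apply: centered; rewrite sv; lia.
Qed.

(** * Regularity of the renewal g-function *)

Lemma ell_some (w : config past) j :
  ell w = Some j <-> w (past_coord j) /\ forall i, (i < j)%N -> w (past_coord i) = false.
Proof.
rewrite /ell; case: pselect => [ex|nex]; last first.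
  by split=> // -[wj _]; case: nex; exists j.
split=> [[<-]|[wj wi]].
  case: ex_minnP => k wk kmin; split=> // i ik; apply/negbTE/negP => /kmin.
  by rewrite leqNgt ik.
congr Some; case: ex_minnP => k wk kmin; apply/eqP; rewrite eqn_leq kmin//=.
by rewrite leqNgt; apply/negP => /wi; rewrite wk.
Qed.

Lemma ell_none (w : config past) :
  ell w = None <-> forall i, w (past_coord i) = false.
Proof.
rewrite /ell; case: pselect => [ex|nex]; split=> //.
  by move=> wi; exfalso; case: ex => j; rewrite wi.
by move=> _ i; apply/negbTE/negP => wi; apply: nex; exists i.
Qed.

Definition recent (n : nat) : seq past := [seq past_coord i | i <- iota 0 n].

Lemma recentP n i : (i < n)%N -> past_coord i \in recent n.
Proof. by move=> lin; apply: map_f; rewrite mem_iota. Qed.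

(** The value of [ell] is decided by finitely many coordinates as soon as a one
    has been seen. *)
Lemma ell_box (w : config past) j : ell w = Some j ->
  forall w', box (recent j.+1) w w' -> ell w' = Some j.
Proof.
move=> /ell_some[wj wi] w' ww'; apply/ell_some; split.
  by rewrite ww' ?recentP.
by move=> i ij; rewrite ww' ?wi// recentP// ltnW.
Qed.

Lemma measurable_ell (S : set (option nat)) :
  measurable [set w : config past | S (ell w)].
Proof.
have mS j : measurable [set w : config past | ell w = Some j].
  pose w0 : config past := fun c => val c == - j%:Z - 1.
  have w0j : ell w0 = Some j.
    apply/ell_some; split; first exact: eqxx.
    by move=> i ij; rewrite /w0/=; apply/negbTE; lia.
  have -> : [set w : config past | ell w = Some j] = box (recent j.+1) w0.
    apply/seteqP; split=> w; last exact: ell_box.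
    move=> wj; have /ell_some[w1 w2] := wj; have /ell_some[v1 v2] := w0j.
    move=> _ /mapP[i + ->]; rewrite mem_iota/= add0n ltnS leq_eqVlt.
    by move=> /predU1P[->|ij]; [rewrite w1 v1|rewrite w2// v2].
  exact: measurable_box.
have mN : measurable [set w : config past | ell w = None].
  have -> : [set w : config past | ell w = None] =
      ~` \bigcup_j [set w : config past | ell w = Some j].
    apply/seteqP; split=> w /=; first by move=> wN [j _ /=]; rewrite wN.
    by case E : (ell w) => [j|//] h; case: h; exists j.
  by apply: measurableC; apply: bigcupT_measurable.
have -> : [set w : config past | S (ell w)] =
    \bigcup_(o in S) [set w : config past | ell w = o].
  apply/seteqP; split=> w /=; first by exists (ell w).
  by move=> [l Sl] /= ->.
rewrite bigcup_mkcond; apply: countable_bigcupT_measurable => //; case=> [j|].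
- by case: ifP.
- by case: ifP.
Qed.

Lemma sigma_coord_restr (L : set int) (A : set (config L)) :
  measurable A -> sigma_coord L (restr L @^-1` A).
Proof.
move=> mA.
have mr : measurable_fun setT
    (restr L : g_sigma_algebraType (coord_events L) -> config L).
  apply: (@measurability _ _ _ _ _ _ (coord_events setT)) => //.
  move=> _ [_ [i _ [Y mY <-]] <-]; apply: sub_sigma_algebra.
  by exists (val i); [exact: set_valP|exists Y => //; rewrite !setTI].
by have := mr measurableT A mA; rewrite setTI.
Qed.

Section RenewalG.
Context {R : realType} (p : nat -> R) (pinf c : R).
Hypotheses (c0 : 0 < c) (pc : forall n, c <= p n <= 1 - c)
  (p_cvg : p n @[n --> \oo] --> pinf).

Let pinf_itv : c <= pinf <= 1 - c.
Proof.
rewrite -(cvg_lim _ p_cvg)//; apply/andP; split.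
  by apply: limr_ge; [apply/cvg_ex; exists pinf|apply: nearW => n; have /andP[] := pc n].
by apply: limr_le; [apply/cvg_ex; exists pinf|apply: nearW => n; have /andP[] := pc n].
Qed.

Lemma renewal_g_itv a w : c <= renewal_g p pinf a w <= 1 - c.
Proof.
rewrite /renewal_g; have := pinf_itv; case: (ell w) => [j|].
  by move=> _; have /andP[? ?] := pc j; case: a; apply/andP; split; lra.
by move=> /andP[? ?]; case: a; apply/andP; split; lra.
Qed.

(** Away from the zero past the function is locally constant; at the zero past
    continuity is the convergence of [p] to [pinf]. *)
Lemma continuous_renewal_g a : continuous (renewal_g p pinf a).
Proof.
suff ct : continuous (renewal_g p pinf true).
  case: a => //; have -> : renewal_g p pinf false = fun w => 1 - renewal_g p pinf true w.
    by apply/funext.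
  by move=> w; apply: cvgB; [exact: cvg_cst|exact: ct].
move=> w; apply/cvgrPdist_lt => e e0.
case E : (ell w) => [j|].
  apply: filterS (box_nbhs (recent j.+1) w) => w' ww'.
  by rewrite /renewal_g E (ell_box E ww') subrr normr0.
move: p_cvg => /cvgrPdist_lt/(_ _ e0)[N _ hN].
apply: filterS (box_nbhs (recent N) w) => w' ww'; rewrite /renewal_g E.
case E' : (ell w') => [k|]; last by rewrite subrr normr0.
apply: hN => /=; rewrite leqNgt; apply/negP => kN.
move/ell_some : E' => [+ _]; rewrite (ww' _ (recentP kN)).
by move/ell_none : E => ->.
Qed.

Lemma measurable_renewal_g a : measurable_fun setT (renewal_g p pinf a).
Proof.
move=> _ Y mY; rewrite setTI.
exact: (measurable_ell
  [set l | Y (let q := if l is Some j then p j else pinf in if a then q else 1 - q)]).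
Qed.

Lemma regular_renewal_g : regular_g_function (renewal_g p pinf).
Proof.
split; [split=> [|a w|w]|exact: continuous_renewal_g|].
- exact: measurable_renewal_g.
- have /andP[h _] := renewal_g_itv a w; exact: le_trans (ltW c0) h.
- by rewrite /renewal_g; ring.
- by exists c => // a w; have /andP[] := renewal_g_itv a w.
Qed.

End RenewalG.

(** * Words of the past *)

Lemma age_last_one s u w : word_at s (true :: u) w ->
  w (s + (size u)%:Z - (age 0 u)%:Z) /\
  forall i, (i < age 0 u)%N -> w (s + (size u)%:Z - i%:Z) = false.
Proof.
have age_rcons k v b : age k (rcons v b) = if b then 0%N else (age k v).+1.
  by elim: v k => //= ?? ih k; rewrite ih.
elim/last_ind: u => [|u b ih]; first by rewrite /= addr0 subr0 => -[].
rewrite -rcons_cons word_at_rcons => -[/ih[w1 w0] /=].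
rewrite size_rcons age_rcons; case: b => wb; first by rewrite subr0.
split; first by rewrite (_ : _ - _ = s + (size u)%:Z - (age 0 u)%:Z)//; lia.
move=> [|i] hi; first by rewrite subr0.
by rewrite (_ : _ - _ = s + (size u)%:Z - i%:Z) ?w0//; lia.
Qed.

(** A past that ends with 1u determines [ell]: it is the age read along [u]. *)
Lemma ell_word_at n u w : size u = n -> word_at (- n.+1%:Z) (true :: u) w ->
  ell (restr past w) = Some (age 0 u).
Proof.
move=> <- /age_last_one[w1 w0]; apply/ell_some; split.
  by rewrite /restr/= (_ : _ - 1 = - (size u).+1%:Z + (size u)%:Z - (age 0 u)%:Z)//; lia.
move=> i ij; rewrite /restr/=.
by rewrite (_ : _ - 1 = - (size u).+1%:Z + (size u)%:Z - i%:Z) ?w0//; lia.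
Qed.

Section GWords.
Context {R : realType} (p : nat -> R) (pinf : R).

Let g a : config int -> R := renewal_g p pinf a \o restr past.

Lemma renewal_g_word_at a n u w : size u = n ->
  word_at (- n.+1%:Z) (true :: u) w -> g a w = step_weight p (age 0 u) a.
Proof. by move=> su /(ell_word_at su); rewrite /g /= /renewal_g => ->. Qed.

Lemma word_at_X0 n u a : size u = n ->
  X0_eq a `&` word_at (- n%:Z) u = word_at (- n%:Z) (rcons u a).
Proof. by move=> <-; rewrite word_at_rcons addNr setIC. Qed.

End GWords.

Lemma sigma_coord_past n u : size u = n -> sigma_coord past (word_at (- n%:Z) u).
Proof. by move=> <-; apply: sigma_coord_word_at => i; rewrite addNr /past/=; lia. Qed.

Section Shift.
Context {R : realType} (nu : probability (config int) R).
Hypothesis nu_shift : shift_invariant nu.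

Lemma shift_invariant_word_at s u : nu (word_at s u) = nu (word_at 0 u).
Proof.
have step i : nu (word_at (i + 1) u) = nu (word_at i u).
  by rewrite -shift_word_at nu_shift//; exact: measurable_word_at.
case: s => n.
  by elim: n => // n ih; rewrite -addn1 PoszD step ih.
rewrite NegzE; elim: n => [|n ih]; first by rewrite -[in RHS](addNr 1) step.
by rewrite -ih -step (_ : - n.+2%:Z + 1 = - n.+1%:Z)//; lia.
Qed.

End Shift.

(** * Uniqueness of the g-measure *)

Section CondProb.
Context {R : realType} (mu : probability (config int) R).

Lemma prob_fineK (A : set (config int)) : measurable A -> (fine (mu A))%:E = mu A.
Proof. by move=> mA; rewrite fineK// fin_num_measure. Qed.

Lemma integral_itv (A : set (config int)) (f : config int -> R) lo hi : measurable A ->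
  mu.-integrable A (EFin \o f) -> (forall w, A w -> lo <= f w <= hi) ->
  (lo%:E * mu A <= \int[mu]_(w in A) (f w)%:E <= hi%:E * mu A)%E.
Proof.
move=> mA fA lohi; rewrite -!(integral_cst mu mA); apply/andP; split.
  apply: le_integral => //; first exact: finite_measure_integrable_cst.
  by move=> w /set_mem/lohi/andP[? _]; rewrite lee_fin.
apply: le_integral => //; first exact: finite_measure_integrable_cst.
by move=> w /set_mem/lohi/andP[_ ?]; rewrite lee_fin.
Qed.

Lemma measurable_X0_eq a : measurable (X0_eq a).
Proof. by apply: (@sigma_coord_measurable _ setT); exact: sigma_coord_coord. Qed.

(** A version is known only almost surely; what can be extracted from it are
    its averages over the events of the conditioning sigma-algebra. *)
Lemma cond_prob_bounds (L : set int) a f A lo hi :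
  cond_prob_version mu (sigma_coord L) (X0_eq a) f -> sigma_coord L A ->
  (forall w, A w -> lo <= f w <= hi) ->
  lo * fine (mu A) <= fine (mu (X0_eq a `&` A)) <= hi * fine (mu A).
Proof.
move=> [_ fint fA] LA lohi; have mA := sigma_coord_measurable LA.
have := integral_itv mA (integrableS measurableT mA (@subsetT _ _) fint) lohi.
rewrite fA// -(prob_fineK mA) -(prob_fineK (measurableI _ _ (measurable_X0_eq a) mA)).
by rewrite -!EFinM !lee_fin.
Qed.

End CondProb.

Section GMeasure.
Context {R : realType} (T : nat -> R) (pinf c : R) (nu : probability (config int) R).
Hypotheses (c0 : 0 < c) (pc : forall n, c <= hazard T n <= 1 - c)
  (p_cvg : hazard T n @[n --> \oo] --> pinf)
  (T0 : T 0 = 1) (Tcvg : T n @[n --> \oo] --> 0)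
  (Tconvex : forall n, 0 < decrement (decrement T) n).

Let p := hazard T.
Let g a : config int -> R := renewal_g p pinf a \o restr past.

Lemma sigma_coord_past_renewal_g a (Y : set R) : measurable Y ->
  sigma_coord past (g a @^-1` Y).
Proof.
move=> mY; rewrite /g comp_preimage; apply: sigma_coord_restr.
by rewrite -[X in measurable X]setTI; exact: measurable_renewal_g.
Qed.

Lemma measurable_renewal_g_restr a : measurable_fun setT (g a).
Proof.
move=> _ Y mY; rewrite setTI; apply: sigma_coord_measurable.
exact: sigma_coord_past_renewal_g.
Qed.

Lemma integrable_renewal_g_restr (mu : probability (config int) R) a :
  mu.-integrable setT (EFin \o g a).
Proof.
apply: measurable_bounded_integrable => //.
- by rewrite [X in (X < _)%E](probability_setT mu) ltry.
- exact: measurable_renewal_g_restr.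
exists 1; split=> // x x1 w _; apply: le_trans (ltW x1).
have /andP[l u] := renewal_g_itv pc p_cvg a (restr past w).
rewrite /g/= ger0_norm; first by apply: le_trans u _; rewrite gerBl ltW.
by apply: le_trans l; exact: ltW.
Qed.

(** The kernel itself is a version, being measurable and almost surely equal to
    the version supplied by the definition. *)
Lemma g_measure_cond_prob a : g_measure (renewal_g p pinf) nu ->
  cond_prob_version nu (sigma_coord past) (X0_eq a) (g a).
Proof.
move=> [_ /(_ a)[f [fY fint fA] fg]]; split.
- exact: sigma_coord_past_renewal_g.
- exact: integrable_renewal_g_restr.
move=> A LA; have mA := sigma_coord_measurable LA; rewrite -(fA A)//.
apply: ae_eq_integral => //.
- apply: (measurable_funS measurableT (@subsetT _ A)) => //.
  exact: measurable_int (integrable_renewal_g_restr nu a).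
- apply: (measurable_funS measurableT (@subsetT _ A)) => //.
  exact: measurable_int fint.
- by apply: filterS fg => w fw _; rewrite fw.
Qed.

(** On 1u the kernel is constant, so conditioning one letter at a time gives the
    transition weights; non-nullness makes 0^n geometrically unlikely, and
    [mass_unique] concludes. *)
Lemma g_measure_unique : g_measure (renewal_g p pinf) nu ->
  forall s u, nu (word_at s u) = (mass T u)%:E.
Proof.
move=> gnu; pose N u := fine (nu (word_at 0 u)).
have NE s u : fine (nu (word_at s u)) = N u.
  by rewrite shift_invariant_word_at//; case: gnu.
suff h u : N u = mass T u.
  by move=> s u; rewrite -h -(NE s) prob_fineK//; exact: measurable_word_at.
have next v a lo hi :
    (forall w, word_at (- (size v)%:Z) v w -> lo <= g a w <= hi) ->
    lo * N v <= N (rcons v a) <= hi * N v.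
  move=> lohi; have := cond_prob_bounds (g_measure_cond_prob a gnu)
    (sigma_coord_past (erefl (size v))) lohi.
  by rewrite word_at_X0// !NE.
move: u; apply: mass_unique => //.
- by rewrite /N /= probability_setT.
- move=> u; rewrite {1}/N word_at_measurel fineD ?fin_num_measure//;
    try exact: measurable_word_at.
  by rewrite !NE.
- elim/last_ind => [|u a ih]; first by rewrite mulr1.
  have := @next (true :: u) a (step_weight p (age 0 u) a) (step_weight p (age 0 u) a).
  move=> /(_ _)/le_anti; rewrite rcons_cons => <-; last first.
    by move=> w uw; rewrite /g (renewal_g_word_at _ _ _ (erefl (size u)) uw) lexx.
  by rewrite ih weight_rcons; ring.
move=> u; apply: (@squeeze_cvgr _ _ _ _ (fun=> 0) (fun n => (1 - c) ^+ n)).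
- apply: nearW => n; rewrite fine_ge0//=.
  have : N (nseq n false) <= (1 - c) ^+ n.
    elim: n => [|n ih]; first by rewrite /N /= probability_setT.
    have /andP[_] := @next (nseq n false) false c (1 - c)
      (fun w _ => renewal_g_itv pc p_cvg false (restr past w)).
    rewrite (_ : rcons _ _ = nseq n.+1 false); last first.
      by rewrite -cats1 -[X in _ ++ X]/(nseq 1 false) -nseqD addn1.
    move=> /le_trans; apply; rewrite exprS ler_wpM2l//.
    by have /andP[? ?] := pc 0; lra.
  apply: le_trans; rewrite /N fine_le ?fin_num_measure//; try exact: measurable_word_at.
  apply: le_measure; [rewrite inE; exact: measurable_word_at..|].
  by rewrite word_at_cat; exact: subIsetl.
- exact: cvg_cst.
- apply: cvg_expr; have /andP[? ?] := pc 0.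
  by rewrite ger0_norm; have := c0; lra.
Qed.

End GMeasure.

(** * Existence of the g-measure *)

Section Density.
Context {d} {X : measurableType d} {R : realType} (mu : {measure set X -> \bar R})
  (f : X -> \bar R).
Hypotheses (mf : measurable_fun setT f) (f0 : forall x, (0 <= f x)%E).

Definition density_measure (A : set X) : \bar R := (\int[mu]_(x in A) f x)%E.

Let density0 : density_measure set0 = 0%E.
Proof. exact: integral_set0. Qed.

Let density_ge0 A : (0 <= density_measure A)%E.
Proof. by apply: integral_ge0. Qed.

HB.instance Definition _ := isMeasure.Build _ _ _ density_measure
  density0 density_ge0 (semi_sigma_additive_nng_induced mf f0).

Lemma density_measureP : exists m : {measure set X -> \bar R},
  forall A, m A = (\int[mu]_(x in A) f x)%E.
Proof. by exists density_measure. Qed.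

End Density.

Lemma measurable_shift : measurable_fun setT (Defs.shift : config int -> config int).
Proof.
apply: (@measurability _ _ _ _ _ _ (coord_events setT)) => //.
move=> _ [_ [i _ [Y mY <-]] <-]; apply: sub_sigma_algebra.
by exists (i + 1) => //; exists Y => //; rewrite !setTI.
Qed.

HB.instance Definition _ :=
  isMeasurableFun.Build _ _ _ _ Defs.shift measurable_shift.

Section Existence.
Context {R : realType} (T : nat -> R) (pinf c : R) (mu : probability (config int) R).
Hypotheses (c0 : 0 < c) (pc : forall n, c <= hazard T n <= 1 - c)
  (p_cvg : hazard T n @[n --> \oo] --> pinf)
  (Tcvg : T n @[n --> \oo] --> 0)
  (Tconvex : forall n, 0 < decrement (decrement T) n)
  (mu_mass : forall s u, mu (word_at s u) = (mass T u)%:E).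

Let p := hazard T.
Let g a : config int -> R := renewal_g p pinf a \o restr past.

Let muT_fin : (mu setT < +oo)%E.
Proof. by rewrite [X in (X < _)%E](probability_setT mu) ltry. Qed.

Lemma mass_shift_invariant : shift_invariant mu.
Proof.
move=> A mA; change (distribution mu Defs.shift A = mu A).
apply: measure_unique_word mA; first exact: muT_fin.
move=> s u; transitivity (mu (Defs.shift @^-1` word_at s u)); first by [].
by rewrite shift_word_at mu_mass; exact/esym/mu_mass.
Qed.

(** Both sides of the defining identity are measures in the conditioning event,
    so words of the past suffice.  The difference is additive in the word, is
    zero on 1u where the kernel is constant, and is small on long runs of
    zeros: [word_vanish] applies. *)
Lemma mass_cond_prob a : cond_prob_version mu (sigma_coord past) (X0_eq a) (g a).
Proof.
have gint := integrable_renewal_g_restr c0 pc p_cvg mu a.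
have g01 w : 0 <= g a w <= 1.
  have /andP[l h] := renewal_g_itv pc p_cvg a (restr past w).
  by rewrite (le_trans (ltW c0) l)/=; apply: le_trans h _; rewrite gerBl ltW.
split=> [Y mY||A]; [exact: sigma_coord_past_renewal_g|exact: gint|].
have g0 w : (0 <= (g a w)%:E)%E by rewrite lee_fin; have /andP[] := g01 w.
have [m mE] := density_measureP mu (measurable_int mu gint) g0.
rewrite -mE setIC; change (sigma_coord past A -> m A = mrestr mu (measurable_X0_eq a) A).
have m_itv n u lo hi : (forall w, word_at n u w -> lo <= g a w <= hi) ->
    (lo%:E * mu (word_at n u) <= m (word_at n u) <= hi%:E * mu (word_at n u))%E.
  move=> lohi; have mw := measurable_word_at n u; rewrite mE.
  exact: integral_itv mw (integrableS measurableT mw (@subsetT _ _) gint) lohi.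
have fm n u : m (word_at n u) \is a fin_num.
  rewrite ge0_fin_numE//; have /andP[_] := @m_itv n u 0 1 (fun w _ => g01 w).
  by move=> /le_lt_trans; apply; rewrite mu_mass -EFinM ltry.
have {}m_itv n u lo hi : (forall w, word_at n u w -> lo <= g a w <= hi) ->
    lo * mass T u <= fine (m (word_at n u)) <= hi * mass T u.
  by move=> /m_itv; rewrite mu_mass -(fineK (fm n u)) -!EFinM !lee_fin.
have mass_m u : fine (m (word_at (- (size u)%:Z) u)) = mass T (rcons u a).
  apply/eqP; rewrite -subr_eq0; apply/eqP; move: u; apply: word_vanish => u.
  - rewrite word_at_measurel fineD// (mass_split Tcvg Tconvex)/=.
    rewrite (_ : - _ - 1 = - (size u).+1%:Z); last by lia.
    by ring.
  - rewrite (_ : fine _ = step_weight p (age 0 u) a * mass T (true :: u)).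
      by rewrite /mass/= weight_rcons /p; ring.
    apply/esym/le_anti/m_itv => w uw.
    by rewrite /g (renewal_g_word_at _ _ _ (erefl (size u)) uw) lexx.
  - apply/norm_cvg0P; apply: (@squeeze_cvgr _ _ _ _ (fun=> 0)
      (fun n => mass T (nseq n false ++ u) + mass T (nseq n false ++ rcons u a))).
    + apply: nearW => n; rewrite normr_ge0/= rcons_cat.
      have /andP[l h] := @m_itv (- (size (nseq n false ++ u))%:Z) (nseq n false ++ u) 0 1
        (fun w _ => g01 w).
      have l' := mass_gt0 Tcvg Tconvex (nseq n false ++ rcons u a).
      by rewrite mul0r in l; rewrite mul1r in h; rewrite ler_norml; apply/andP; split; lra.
    + exact: cvg_cst.
    + rewrite -[X in _ --> X](addr0 0).
      by apply: cvgD; exact: mass_zeros_cvg0.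
apply: sigma_coord_unique_word.
  rewrite (_ : setT = word_at 0 [::])// -ge0_fin_numE//; exact: fm.
move=> J Jpast; have [k Jk] := subset_window J.
exists (- k%:Z), k; split=> [i iJ|u su].
  move: (Jk i iJ) (Jpast i iJ); rewrite !mem_window /past/=; lia.
change (m (word_at (- k%:Z) u) = mu (word_at (- k%:Z) u `&` X0_eq a)).
rewrite setIC word_at_X0// mu_mass -mass_m su fineK//; exact: fm.
Qed.

Lemma mass_g_measure : g_measure (renewal_g p pinf) mu.
Proof.
split=> [|a]; first exact: mass_shift_invariant.
exists (g a); first exact: mass_cond_prob.
exact: (@filterE _ _ (ae_filter_ringOfSetsType mu)).
Qed.

Lemma mass_non_null : non_null mu.
Proof.
move=> J v; have [k Jk] := subset_window J.
have : (0 < mu (box (window (- k%:Z) k.*2.+1) v))%E.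
  by rewrite -word_at_box mu_mass lte_fin mass_gt0.
move=> /lt_le_trans/(_ (le_measure _ _ _ (boxS Jk))) h.
by rewrite gt_eqF// h// inE; exact: measurable_box.
Qed.

End Existence.

(** * Two-sided conditional probabilities near the zero configuration *)

(** Ones at both ends, and the letter [x] between two runs of zeros; in
    [punctured_gap] the letter [x] sits at the origin and is left free. *)
Definition gap_word (a b : nat) (x : bool) : seq bool :=
  true :: nseq a false ++ x :: nseq b false ++ [:: true].

Definition punctured_window (a b : nat) : seq int :=
  [seq i <- window (- a.+1%:Z) (a + b).+3 | i != 0].

Definition punctured_gap (a b : nat) : set (config int) :=
  box (punctured_window a b) (fun i => (i == - a.+1%:Z) || (i == b.+1%:Z)).

Lemma X0_punctured_gap a b x :
  X0_eq x `&` punctured_gap a b = word_at (- a.+1%:Z) (gap_word a b x).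
Proof.
rewrite /gap_word word_at_cons word_at_cat size_nseq word_at_cons word_at_cat size_nseq.
rewrite (_ : - a.+1%:Z + 1 + a%:Z = 0); last by lia.
rewrite (_ : 0 + 1 + b%:Z = b.+1%:Z); last by lia.
apply/seteqP; split=> w.
  move=> [w0 wK]; have wi i : - a.+1%:Z <= i <= b.+1%:Z -> i != 0 ->
      w i = (i == - a.+1%:Z) || (i == b.+1%:Z).
    by move=> h i0; apply: wK; rewrite mem_filter i0 mem_window; lia.
  split; first by rewrite /= wi ?eqxx//; lia.
  split; first by apply/word_at_zeros => i h; rewrite wi; lia.
  split; first by [].
  split; first by apply/word_at_zeros => i h; rewrite wi; lia.
  by split=> //=; rewrite wi ?eqxx ?orbT//; lia.
move=> [wa [/word_at_zeros wl [wx [/word_at_zeros wr [wb _]]]]].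
split=> // i; rewrite mem_filter mem_window => /andP[i0 h].
have [->|ia] /= := eqVneq i (- a.+1%:Z); first exact: wa.
have [->|ib] /= := eqVneq i (b.+1%:Z); first exact: wb.
by have [il|ir] := ltrP i 0; [apply: wl|apply: wr]; lia.
Qed.

Section Discontinuity.
Context {R : realType} (T : nat -> R) (r B : R) (mu : probability (config int) R).
Hypotheses (Tcvg : T n @[n --> \oo] --> 0)
  (Tconvex : forall n, 0 < decrement (decrement T) n)
  (mu_mass : forall s u, mu (word_at s u) = (mass T u)%:E)
  (r0 : 0 < r)
  (ratio : decrement (decrement T) n.+1 / decrement (decrement T) n @[n --> \oo] --> r)
  (bounded : forall n, decrement (decrement T) n / r ^+ n <= B)
  (divergent : ~ cvgn (fun n => decrement (decrement T) n / r ^+ n)).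

Let E := decrement (decrement T).
Let H a b := E (a + b).+1.
Let K a b := E a * E b / decrement T 0.

Let D0 : 0 < decrement T 0. Proof. exact: decrement_gt0. Qed.

Let mu_gap a b x : fine (mu (X0_eq x `&` punctured_gap a b)) = if x then K a b else H a b.
Proof.
rewrite X0_punctured_gap mu_mass/=; case: x; first exact: mass_gap2.
rewrite /gap_word -[false :: _]/(nseq 1 false ++ _) !catA -!nseqD addn1 addSn.
exact: mass_gap1.
Qed.

Let measurable_gap a b : measurable (punctured_gap a b).
Proof. exact: measurable_box. Qed.

Let mu_punctured_gap a b : fine (mu (punctured_gap a b)) = H a b + K a b.
Proof.
have -> : punctured_gap a b =
    (X0_eq false `&` punctured_gap a b) `|` (X0_eq true `&` punctured_gap a b).
  rewrite -setIUl; apply/seteqP; split=> w; last by case.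
  by move=> wu; split=> //; rewrite /X0_eq/=; case: (w 0); [right|left].
have mX x : measurable (X0_eq x `&` punctured_gap a b).
  by apply: measurableI => //; exact: measurable_X0_eq.
rewrite measureU//; last first.
  by rewrite /X0_eq; apply/seteqP; split=> // w [[/= wf _] [/= wt _]]; rewrite wf in wt.
by rewrite fineD ?fin_num_measure// !mu_gap.
Qed.

Let ratio_iter k : E (a + k)%N / E a @[a --> \oo] --> r ^+ k.
Proof.
elim: k => [|k ih].
  apply: (@cvgn_ext R (fun=> 1)); last exact: cvg_cst.
  by move=> a; rewrite addn0 divff// gt_eqF// Tconvex.
rewrite exprS; apply: (@cvgn_ext R
  (fun a => E (a + k).+1 / E (a + k)%N * (E (a + k)%N / E a))).
  by move=> a; rewrite addnS mulrA divfK// gt_eqF// Tconvex.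
apply: cvgM => //.
by rewrite (@cvg_shiftn k _ (fun n => E n.+1 / E n)).
Qed.

(** If [g] were continuous at the zero configuration with value [g0], then on
    the punctured gaps with a, b large the proportion of X_0 = 0, which is
    H a b / (H a b + K a b), would be close to [g0].  Letting a tend to
    infinity first, the limits 1 / (1 + x b) would converge to [g0], hence x b
    would converge, against the divergence of E b / r^b. *)
Lemma mass_ess_discontinuous : ess_discontinuous mu (fun=> false).
Proof.
move=> [g [cp gc]]; set g0 := g (restr off0 (fun=> false)).
have near_gap (e : R) : 0 < e -> exists N, forall a b, (N <= a)%N -> (N <= b)%N ->
    (g0 - e) * (H a b + K a b) <= H a b <= (g0 + e) * (H a b + K a b).
  move=> e0.
  have [J JU] : exists J : seq off0, box J (restr off0 (fun=> false)) `<=`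
      [set v | `|g0 - g v| < e].
    by apply: nbhs_box; move/cvgrPdist_lt : gc => /(_ _ e0).
  have [N JN] := subset_window [seq val j | j <- J].
  exists N => a b Na Nb; rewrite -mu_punctured_gap -[H a b](mu_gap a b false).
  apply: (cond_prob_bounds cp).
    apply: sigma_coord_box => i; rewrite mem_filter => /andP[/eqP i0 _].
    exact: i0.
  move=> w wA; suff : `|g0 - g (restr off0 w)| < e.
    by rewrite ltr_norml /= => /andP[? ?]; apply/andP; split; lra.
  have w0 k : k != 0 -> k \in window (- N%:Z) N.*2.+1 -> w k = false.
    rewrite mem_window => k0 kN.
    by rewrite wA; [apply/negbTE; lia|rewrite mem_filter k0 mem_window; lia].
  apply: JU => j jJ; apply: w0; last exact: JN (map_f _ jJ).
  by have := set_valP j => /eqP.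
pose x b := E b / (r ^+ b.+1 * decrement T 0).
have rpos n : 0 < r ^+ n by exact: exprn_gt0.
have x0 b : 0 < x b by rewrite divr_gt0 ?mulr_gt0 ?Tconvex.
have near_b (e : R) : 0 < e -> exists N, forall b, (N <= b)%N ->
    (g0 - e) * (1 + x b) <= 1 <= (g0 + e) * (1 + x b).
  move=> /near_gap[N hN]; exists N => b Nb.
  have lim1 : H a b / E a @[a --> \oo] --> r ^+ b.+1.
    apply: (@cvgn_ext R (fun a => E (a + b.+1)%N / E a)); last exact: ratio_iter.
    by move=> a; rewrite addnS.
  have lim2 c : c * (H a b / E a + E b / decrement T 0) @[a --> \oo] -->
      c * (r ^+ b.+1 + E b / decrement T 0).
    by apply: cvgM; [exact: cvg_cst|apply: cvgD => //; exact: cvg_cst].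
  have scale c : c * (r ^+ b.+1 + E b / decrement T 0) = c * (1 + x b) * r ^+ b.+1.
    rewrite /x; field; rewrite !gt_eqF//.
  have div a c : c * (H a b / E a + E b / decrement T 0) = c * (H a b + K a b) / E a.
    by rewrite /K; field; rewrite !gt_eqF// Tconvex.
  have l1 : (g0 - e) * (r ^+ b.+1 + E b / decrement T 0) <= r ^+ b.+1.
    apply: (ler_cvg_to (lim2 _) lim1); exists N => // a /= Na.
    by rewrite div ler_pM2r ?invr_gt0 ?Tconvex//; have /andP[] := hN a b Na Nb.
  have l2 : r ^+ b.+1 <= (g0 + e) * (r ^+ b.+1 + E b / decrement T 0).
    apply: (ler_cvg_to lim1 (lim2 _)); exists N => // a /= Na.
    by rewrite div ler_pM2r ?invr_gt0 ?Tconvex//; have /andP[] := hN a b Na Nb.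
  rewrite scale -[leRHS]mul1r ler_pM2r// in l1.
  by rewrite scale -[leLHS]mul1r ler_pM2r// in l2; rewrite l1 l2.
have y_cvg : (1 + x b)^-1 @[b --> \oo] --> g0.
  apply/cvgrPdist_le => e /near_b[N hN]; exists N => // b /= /hN /andP[l1 l2].
  have xb : 0 < 1 + x b by rewrite ltr_wpDl.
  rewrite -ler_pdivlMr// mul1r in l1; rewrite -ler_pdivrMr// mul1r in l2.
  by rewrite ler_norml; apply/andP; split; lra.
pose C := B / (r * decrement T 0).
have xC b : x b <= C.
  have -> : x b = E b / r ^+ b / (r * decrement T 0).
    by rewrite /x exprS; field; rewrite !gt_eqF.
  by rewrite ler_pM2r ?invr_gt0 ?mulr_gt0.
have C0 : 0 < 1 + C by have := xC 0; have := x0 0; lra.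
have g0_gt0 : 0 < g0.
  apply: (@lt_le_trans _ _ (1 + C)^-1); first by rewrite invr_gt0.
  rewrite -(cvg_lim _ y_cvg)//; apply: limr_ge; first by apply/cvg_ex; exists g0.
  apply: nearW => b; rewrite lef_pV2 ?posrE ?lerD2l//.
  by have := x0 b; lra.
apply: divergent; apply/cvg_ex; exists ((g0^-1 - 1) * (r * decrement T 0)).
have eqx b : ((1 + x b)^-1^-1 - 1) * (r * decrement T 0) =
    decrement (decrement T) b / r ^+ b.
  rewrite invrK addrC addKr /x exprS /E; field; rewrite !gt_eqF//.
apply: (cvgn_ext eqx); apply: cvgM; last exact: cvg_cst.
apply: cvgB; last exact: cvg_cst.
by apply: cvgV => //; rewrite gt_eqF.
Qed.

End Discontinuity.

(** * A slowly oscillating renewal sequence *)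

Section Osc.
Context {R : realType}.

(** The fractional part of a piecewise linear version of log_2 (n+1). *)
Definition saw (n : nat) : R := n.+1%:R / 2 ^+ trunc_log 2 n.+1 - 1.

(** Reversing every other tooth removes the jumps of [saw] at powers of 2. *)
Definition osc (n : nat) : R :=
  if odd (trunc_log 2 n.+1) then 1 - saw n else saw n.

Lemma saw_itv n : 0 <= saw n < 1.
Proof.
have /andP[l u] : (2 ^ trunc_log 2 n.+1 <= n.+1 < 2 ^ (trunc_log 2 n.+1).+1)%N.
  by apply: trunc_log_bounds.
have h : (0:R) < 2 ^+ trunc_log 2 n.+1 by apply: exprn_gt0.
rewrite /saw subr_ge0 ltrBlDr ler_pdivlMr// ltr_pdivrMr// mul1r.
by rewrite -natrX ler_nat l/= -[1 + 1]/(2%:R) -natrM ltr_nat -expnS.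
Qed.

Lemma osc_itv n : 0 <= osc n <= 1.
Proof.
rewrite /osc; have := saw_itv n.
by case: odd => /andP[? ?]; apply/andP; split; lra.
Qed.

(** While n + 1 runs from 2^k to 2^(k+1) the slope is 2^-k up to sign, also
    across the end of this block, and 2^-k is at most 2 / (n+1) there. *)
Lemma oscS n : `|osc n.+1 - osc n| <= 2 / n.+1%:R.
Proof.
set k := trunc_log 2 n.+1.
have /andP[l u] : (2 ^ k <= n.+1 < 2 ^ k.+1)%N by apply: trunc_log_bounds.
have h : (0:R) < 2 ^+ k by apply: exprn_gt0.
have step : `|osc n.+1 - osc n| <= (2 ^+ k)^-1.
  have [u'|u'] := ltnP n.+2 (2 ^ k.+1).
    have k' : trunc_log 2 n.+2 = k.
      by apply: trunc_log_eq => //; rewrite u' andbT (leq_trans l).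
    rewrite /osc /saw k' -/k -[n.+2]addn1 natrD mulrDl mul1r.
    have i0 : (0:R) < (2 ^+ k)^-1 by rewrite invr_gt0.
    set A := _ / _; move: (2 ^- k) i0 => B i0.
    by case: odd; rewrite ler_norml; apply/andP; split; lra.
  have e : n.+2 = (2 ^ k.+1)%N by apply/eqP; rewrite eqn_leq u u'.
  have k' : trunc_log 2 n.+2 = k.+1 by rewrite e trunc_expnK.
  (* At the end of a block n + 2 is the next power of 2. *)
  have e' : n.+1%:R = 2 * 2 ^+ k - 1 :> R.
    have : n.+2%:R = 2 * 2 ^+ k :> R by rewrite e natrX exprS.
    by rewrite -[n.+2]addn1 natrD; lra.
  rewrite /osc /saw k' -/k /= e natrX divff ?expf_neq0// e' mulrBl mulfK ?gt_eqF//.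
  have i0 : (0:R) < (2 ^+ k)^-1 by rewrite invr_gt0.
  move: (2 ^- k : R) i0 => B i0.
  by case: odd; rewrite /= ler_norml; apply/andP; split; lra.
apply: le_trans step _.
rewrite ler_pdivlMr ?ltr0n// ler_pdivrMl//.
by rewrite -natrX -natrM ler_nat mulnC -expnS ltnW.
Qed.

Lemma osc_pow2 k : osc (2 ^ k).-1 = (odd k)%:R.
Proof.
rewrite /osc /saw prednK ?expn_gt0// trunc_expnK// natrX divff ?expf_neq0//.
by rewrite subrr subr0; case: odd.
Qed.

Lemma oscS_cvg : (osc n.+1 - osc n) @[n --> \oo] --> 0.
Proof.
apply/norm_cvg0P; apply: (@squeeze_cvgr _ _ _ _ (fun=> 0) (fun n => 2 * n.+1%:R^-1)).
- by near=> n; rewrite normr_ge0 oscS.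
- exact: cvg_cst.
- rewrite -[X in _ --> X](mulr0 2); apply: cvgM; first exact: cvg_cst.
  exact: (@cvg_harmonic R).
Unshelve. all: by end_near. Qed.

(** Along n + 1 = 2^k the values alternate between 0 and 1. *)
Lemma osc_divergent : ~ cvgn osc.
Proof.
move=> /cvg_ex[/= l ol].
have /cvgrPdist_lt/(_ (2^-1)) := ol; rewrite invr_gt0 ltr0n => /(_ isT)[N _ hN].
have NN k : (N <= k)%N -> (N <= (2 ^ k).-1)%N.
  by move=> /leq_trans; apply; rewrite -ltnS prednK ?expn_gt0// ltn_expl.
have := hN (2 ^ N.*2).-1 (NN _ _); have := hN (2 ^ N.*2.+1).-1 (NN _ _).
rewrite !osc_pow2 /= odd_double/= -addnn.
move=> /(_ (leqW (leq_addl _ _))) /ltr_normlP[? ?].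
by move=> /(_ (leq_addl _ _)) /ltr_normlP[? ?]; lra.
Qed.

End Osc.

Section Void.
Context {R : realType}.

Definition tau (n : nat) : R := 1 + osc n.

(** The decay rate 8^-1 is small enough for the factor [tau], which varies by
    at most a factor 2, not to destroy convexity. *)
Definition void_prob (n : nat) : R := 8^-1 ^+ n * tau n.

Let d (n : nat) : R := tau n - tau n.+1 / 8.
Let e (n : nat) : R := tau n - tau n.+1 / 4 + tau n.+2 / 64.

Let tau_itv n : 1 <= tau n <= 2.
Proof. by have := @osc_itv R n; rewrite /tau => /andP[? ?]; apply/andP; split; lra. Qed.

Let decE n : decrement void_prob n = 8^-1 ^+ n * d n.
Proof. by rewrite /decrement /void_prob /d exprS; field. Qed.

Lemma decrement2_void_prob n : decrement (decrement void_prob) n = 8^-1 ^+ n * e n.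
Proof. by rewrite /decrement /void_prob /e !exprS; field. Qed.

Let d_itv n : 3/4 <= d n <= 2.
Proof.
by have /andP[? ?] := tau_itv n; have /andP[? ?] := tau_itv n.+1; rewrite /d;
  apply/andP; split; lra.
Qed.

Let e_itv n : 1/2 <= e n <= 3.
Proof.
by have /andP[? ?] := tau_itv n; have /andP[? ?] := tau_itv n.+1;
  have /andP[? ?] := tau_itv n.+2; rewrite /e; apply/andP; split; lra.
Qed.

Let pow_gt0 n : (0 : R) < 8^-1 ^+ n.
Proof. by rewrite exprn_gt0// invr_gt0. Qed.

Lemma void_prob0 : void_prob 0 = 1.
Proof. by rewrite /void_prob /tau (@osc_pow2 R 0)/= expr0 mul1r addr0. Qed.

Lemma void_prob_cvg0 : void_prob n @[n --> \oo] --> 0.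
Proof.
apply: (@squeeze_cvgr _ _ _ _ (fun=> 0) (fun n => 8^-1 ^+ n * 2)).
- near=> n; have /andP[? ?] := tau_itv n.
  by rewrite /void_prob mulr_ge0 ?ler_wpM2l ?(ltW (pow_gt0 _))//; lra.
- exact: cvg_cst.
- rewrite -[X in _ --> X](mul0r 2); apply: cvgM; last exact: cvg_cst.
  by apply: cvg_expr; rewrite ger0_norm; lra.
Unshelve. all: by end_near. Qed.

Lemma decrement2_void_prob_gt0 n : 0 < decrement (decrement void_prob) n.
Proof. by rewrite decrement2_void_prob mulr_gt0//; have /andP[? ?] := e_itv n; lra. Qed.

Lemma hazard_itv n : 1/4 <= hazard void_prob n <= 31/32.
Proof.
have -> : hazard void_prob n = e n / d n.
  by rewrite /hazard decrement2_void_prob decE invfM mulrACA divff ?mul1r// gt_eqF.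
have /andP[d1 d2] := d_itv n; have /andP[e1 e2] := e_itv n.
have d0 : 0 < d n by lra.
rewrite ler_pdivlMr// ler_pdivrMr//; apply/andP; split; first lra.
have /andP[? ?] := tau_itv n; have /andP[? ?] := tau_itv n.+1.
by have /andP[? ?] := tau_itv n.+2; rewrite /e /d; lra.
Qed.

Let tauS_cvg : (tau n.+1 - tau n) @[n --> \oo] --> 0.
Proof.
apply: cvg_trans (@oscS_cvg R); apply: near_eq_cvg; apply: nearW => n.
by rewrite /tau; ring.
Qed.

Let e_d (n : nat) : e n = 7/8 * d n
   + ((tau n.+2 - tau n.+1) - 8 * (tau n.+1 - tau n)) / 64.
Proof. by rewrite /e /d; field. Qed.

Let quot_cvg (u v : nat -> R) (l c : R) : 0 < c -> (forall n, c <= v n) ->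
  u n - l * v n @[n --> \oo] --> 0 -> u n / v n @[n --> \oo] --> l.
Proof.
move=> c0 cv uv.
have v0 n : 0 < v n by apply: lt_le_trans (cv n).
rewrite -[X in _ --> X]addr0.
have F n : l + (u n - l * v n) / v n = u n / v n.
  by rewrite mulrBl mulfK ?gt_eqF// addrC subrK.
apply: (cvgn_ext F).
apply: cvgD; first exact: cvg_cst.
apply/norm_cvg0P.
apply: (@squeeze_cvgr _ _ _ _ (fun=> 0) (fun n => `|u n - l * v n| / c)).
- near=> n; rewrite normr_ge0 normrM ler_wpM2l// normfV (gtr0_norm (v0 n)).
  by rewrite lef_pV2 ?posrE.
- exact: cvg_cst.
- rewrite -[X in _ --> X](mul0r c^-1); apply: cvgM; last exact: cvg_cst.
  exact/norm_cvg0P.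
Unshelve. all: by end_near. Qed.

Let shift_cvg (u : nat -> R) (l : R) : u n @[n --> \oo] --> l -> u n.+1 @[n --> \oo] --> l.
Proof. by move=> ul; rewrite (@cvg_shiftS _ u). Qed.

Lemma hazard_void_prob_cvg : hazard void_prob n @[n --> \oo] --> (7/8 : R).
Proof.
have E n : e n / d n = hazard void_prob n.
  by rewrite /hazard decrement2_void_prob decE invfM mulrACA divff ?mul1r// gt_eqF.
apply: (cvgn_ext E).
apply: (@quot_cvg _ _ _ (3/4)); first lra.
  by move=> n; have /andP[] := d_itv n.
rewrite -[X in _ --> X](_ : (0 - 8 * 0) / 64 = 0); last by rewrite mulr0 subrr mul0r.
apply: (@cvgn_ext R (fun n => ((tau n.+2 - tau n.+1) - 8 * (tau n.+1 - tau n)) / 64)).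
  by move=> n; rewrite e_d [RHS]addrC addKr.
apply: cvgM; last exact: cvg_cst.
apply: cvgB; first exact: (shift_cvg (u := fun n => tau n.+1 - tau n)).
by apply: cvgM; [exact: cvg_cst|].
Qed.

Lemma decrement2_void_prob_ratio_cvg :
  decrement (decrement void_prob) n.+1 / decrement (decrement void_prob) n
    @[n --> \oo] --> (8^-1 : R).
Proof.
have E n : 8^-1 * (e n.+1 / e n) =
    decrement (decrement void_prob) n.+1 / decrement (decrement void_prob) n.
  rewrite !decrement2_void_prob exprS; field; have /andP[? ?] := e_itv n.
  by rewrite !gt_eqF//; lra.
apply: (cvgn_ext E).
rewrite -[X in _ --> X]mulr1; apply: cvgM; first exact: cvg_cst.
apply: (@quot_cvg _ _ _ (1/2)); first lra.
  by move=> n; have /andP[] := e_itv n.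
have F n : (tau n.+1 - tau n) - (tau n.+2 - tau n.+1) / 4
   + (tau n.+3 - tau n.+2) / 64 = e n.+1 - 1 * e n.
  by rewrite /e; field.
rewrite -[X in _ --> X](_ : 0 - 0 / 4 + 0 / 64 = 0); last by rewrite !mul0r; ring.
apply: (cvgn_ext F).
have s1 := shift_cvg tauS_cvg; have s2 := shift_cvg s1.
apply: cvgD; last by apply: cvgM; [exact: s2|exact: cvg_cst].
by apply: cvgB => //; apply: cvgM; [exact: s1|exact: cvg_cst].
Qed.

Lemma decrement2_void_prob_scaled_itv n :
  1/2 <= 8 ^+ n * decrement (decrement void_prob) n <= 3.
Proof.
rewrite decrement2_void_prob mulrA -exprMn divff// expr1n (mul1r (e n)).
exact: e_itv.
Qed.

(** Up to terms tending to 0, the scaled sequence is 49/64 (1 + osc n), where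
    49/64 = (1 - 1/8)^2. *)
Lemma decrement2_void_prob_scaled_divergent :
  ~ cvgn (fun n => 8 ^+ n * decrement (decrement void_prob) n).
Proof.
have E n : e n = 8 ^+ n * decrement (decrement void_prob) n.
  by rewrite decrement2_void_prob mulrA -exprMn divff ?expr1n ?mul1r.
rewrite -(funext E).
move=> /cvg_ex[/= l el]; apply: (@osc_divergent R).
(* Solve e n = 49/64 tau n + o(1) for osc n. *)
apply/cvg_ex; exists (64/49 * l - 1).
have F n : 64/49 * (e n + (tau n.+1 - tau n) * (15/64)
    - (tau n.+2 - tau n.+1) / 64) - 1 = osc n.
  by rewrite /e /tau; field.
apply: (cvgn_ext F).
apply: cvgB; last exact: cvg_cst.
apply: cvgM; first exact: cvg_cst.
rewrite -[X in _ --> X](_ : l + 0 * (15/64) - 0 / 64 = l); last by rewrite !mul0r; ring.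
apply: cvgB; last by apply: cvgM; [exact: shift_cvg tauS_cvg|exact: cvg_cst].
by apply: cvgD => //; apply: cvgM; [|exact: cvg_cst].
Qed.

End Void.

(** * Essential discontinuity for the oscillating sequence *)

Theorem theorem3 (R : realType) :
  exists (p : nat -> R) (pinf : R),
    [/\ forall i, 0 < p i < 1,
        0 < inf (range p),
        p i @[i --> \oo] --> pinf,
        pinf < 1
      & regular_g_function (renewal_g p pinf) /\
        exists mu : probability (config int) R,
          [/\ g_measure (renewal_g p pinf) mu,
              forall nu : probability (config int) R,
                g_measure (renewal_g p pinf) nu ->
                forall A, measurable A -> nu A = mu A,
              non_null mu
            & ess_discontinuous mu (fun _ : int => false)]].
Proof.
have cvg0 := @void_prob_cvg0 R; have convex := @decrement2_void_prob_gt0 R.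
have hz n : 1/32 <= @hazard R void_prob n <= 1 - 1/32.
  by have /andP[? ?] := @hazard_itv R n; apply/andP; split; lra.
have c0 : (0 : R) < 1/32 by lra.
have hz_cvg := @hazard_void_prob_cvg R.
exists (hazard void_prob), (7/8); split => //.
- exact: hazard01.
- apply: (@lt_le_trans _ _ (1/4)); first lra.
  apply: lb_le_inf; first by exists (hazard void_prob 0), 0%N.
  by move=> _ [n _ <-]; have /andP[] := @hazard_itv R n.
- lra.
split; first exact: (regular_renewal_g c0 hz hz_cvg).
have [mu muE] : exists mu : probability (config int) R,
    forall s u, mu (word_at s u) = (mass void_prob u)%:E.
  apply: stationary_extension.
  - by rewrite mass_nil// void_prob0.
  - by move=> u; rewrite ltW// mass_gt0.
  - exact: mass_split.
  - exact: mass_rcons.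
exists mu; split.
- exact: (mass_g_measure c0 hz hz_cvg).
- move=> nu gnu; apply: measure_unique_word.
    by rewrite [X in (X < _)%E](probability_setT nu) ltry.
  move=> s u; transitivity (@mass R void_prob u)%:E; last exact/esym/muE.
  by apply: (g_measure_unique c0 hz hz_cvg) => //; exact: void_prob0.
- exact: (mass_non_null cvg0 convex muE).
have scaled n : 8 ^+ n * decrement (decrement void_prob) n =
    decrement (decrement void_prob) n / 8^-1 ^+ n :> R.
  by rewrite exprVn invrK mulrC.
apply: (mass_ess_discontinuous (r := 8^-1) (B := 3) cvg0 convex muE).
- by rewrite invr_gt0.
- exact: decrement2_void_prob_ratio_cvg.
- by move=> n; rewrite -scaled; have /andP[] := @decrement2_void_prob_scaled_itv R n.
- by rewrite -(funext scaled); exact: decrement2_void_prob_scaled_divergent.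
Qed.
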